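(* Let $\mathcal{K}$ be a regular $n$-polytope that is $(1,n-1)$-flat. Then no finite chiral $(n+1)$-polytope has facets isomorphic to $\mathcal{K}$.
   Context: An (abstract) $n$-polytope is a partially ordered set with a unique minimal face $F_{-1}$ and a unique maximal face $F_n$, all of whose maximal chains (flags) have the same length, graded by a rank function with $\operatorname{rank}F_{-1}=-1$, $\operatorname{rank}F_n=n$, satisfying the diamond condition (if $F<G$ with rank difference $2$, exactly two faces lie strictly between them) and strong connectivity (if $F<G$ with rank difference at least $3$, any two faces strictly between $F$ and $G$ are joined by a chain $H_0\le H_1\ge H_2\le\cdots$ of faces strictly between $F$ and $G$). Faces of rank $0$ are vertices, of rank $n-1$ facets; a facet $F$ is identified with the $(n-1)$-polytope $\{H: F_{-1}\le H\le F\}$. Flags differing in exactly one face are adjacent. A polytope is regular if its automorphism group (rank- and order-preserving bijections) acts transitively on flags, and chiral if the flags form two orbits with adjacent flags in different orbits. For $0\le k<m\le n-1$, an $n$-polytope is $(k,m)$-flat if every face of rank $k$ is incident with (comparable to) every face of rank $m$. *)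

(* Defs.v *)
From HB Require Import structures.
From mathcomp Require Import all_boot all_order all_algebra.
From mathcomp Require Import boolp classical_sets functions cardinality.

Set Implicit Arguments.
Unset Strict Implicit.
Unset Printing Implicit Defensive.

Import Order.TTheory GRing.Theory Num.Theory.
Local Open Scope classical_set_scope.
Local Open Scope card_scope.
Local Open Scope order_scope.

Section Chains.
Variables (d : Order.disp_t) (T : porderType d).

Definition chain (C : set T) : Prop := forall x y, C x -> C y -> x >=< y.

Definition flags : set (set T) :=
  [set C | chain C /\ forall D, chain D -> C `<=` D -> D = C].

Definition adjacent (C D : set T) : Prop :=
  exists x y, C `\` D = [set x] /\ D `\` C = [set y].

Definition covers (x y : T) : Prop := x < y /\ ~ exists z, x < z < y.

(* H 0 <= H 1 >= H 2 <= ... >= H k, all strictly between F and G *)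
Definition joined_between (F G x y : T) : Prop :=
  exists (k : nat) (H : nat -> T),
    [/\ H 0 = x, H k = y,
        forall i, (i <= k)%N -> F < H i < G &
        forall i, (i < k)%N ->
          if odd i then H i.+1 <= H i else H i <= H i.+1].

End Chains.

Arguments flags {d} T.

(* \bot is F_{-1} and \top is F_n. *)
Record polytope (d : Order.disp_t) (n : nat) := Polytope {
  face :> tbPOrderType d;
  rank : face -> int;
  rank_bot : rank \bot = (- 1)%R;
  rank_top : rank \top = n%:Z%R;
  rank_lt : forall x y : face, x < y -> (rank x < rank y)%R;
  rank_covers : forall x y : face, covers x y -> rank y = (rank x + 1)%R;
  flags_same_length :
    forall C D : set face, flags face C -> flags face D -> C #= D;
  diamond : forall F G : face, F < G -> (rank G - rank F = 2)%R ->
    [set H | F < H < G] #= `I_2;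
  strongly_connected : forall F G : face, F < G -> (3 <= rank G - rank F)%R ->
    forall x y : face, F < x < G -> F < y < G -> joined_between F G x y
}.

Arguments rank {d n p} _.

Section Symmetry.
Variables (d : Order.disp_t) (n : nat) (P : polytope d n).

Definition automorphism (f : P -> P) : Prop :=
  [/\ bijective f, {mono f : x y / x <= y} & forall x, rank (f x) = rank x].

Definition flag_orbit (C : set P) : set (set P) :=
  [set f @` C | f in automorphism].

Definition regular_polytope : Prop :=
  forall C D : set P, flags P C -> flags P D -> flag_orbit C D.

Definition chiral_polytope : Prop :=
  [set flag_orbit C | C in flags P] #= `I_2 /\
  forall C D : set P, flags P C -> flags P D -> adjacent C D ->
    flag_orbit C <> flag_orbit D.

Definition facet (F : P) : Prop := rank F = (n%:Z - 1)%R.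

Definition flat (k m : int) : Prop :=
  [/\ (0 <= k)%R, (k < m)%R, (m <= n%:Z - 1)%R &
      forall x y : P, rank x = k -> rank y = m -> x >=< y].

End Symmetry.

(* The facet F of P, as the polytope of the faces below it, is isomorphic
   to K; only the values of f on those faces matter. *)
Definition facet_isomorphic (dP dK : Order.disp_t) (m n : nat)
    (P : polytope dP m) (K : polytope dK n) (F : P) : Prop :=
  exists f : P -> K,
    [/\ set_bij [set H | \bot <= H <= F] [set: K] f,
        forall G H : P, G <= F -> H <= F -> (f G <= f H) = (G <= H) &
        forall H : P, H <= F -> rank (f H) = rank H].

Definition has_facets_isomorphic_to (dP dK : Order.disp_t) (m n : nat)
    (P : polytope dP m) (K : polytope dK n) : Prop :=
  forall F : P, facet F -> facet_isomorphic K F.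

(* Main.v *)
(** Suppose [P] is an [(n+1)]-polytope with facets isomorphic to [K], and fix
    an edge [e] with vertices [v] and [v'].  Flatness puts [e] below every ridge
    of a facet containing [e], so by connectivity [e] lies below every facet
    and every ridge of [P].  As [K] is regular, each facet [F] has a unique
    automorphism [f_F] that swaps [v] and [v'] and fixes all faces between [e]
    and [F].  For facets [F], [G] sharing a ridge [R], both [f_F] and [f_G]
    restrict to the unique automorphism of [R] with this property, so they
    agree below [R]; by strong connectivity they agree on every common face of
    any two facets.  The [f_F] thus glue to an automorphism of [P] sending a
    flag to its 0-adjacent flag, and [P] is not chiral. *)
Require Import Defs.
From HB Require Import structures.
From mathcomp Require Import all_boot all_order all_algebra.
From mathcomp Require Import boolp classical_sets functions cardinality.
From mathcomp Require Import zify.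

Set Implicit Arguments.
Unset Strict Implicit.
Unset Printing Implicit Defensive.

Import Order.TTheory GRing.Theory Num.Theory.
Local Open Scope classical_set_scope.
Local Open Scope ring_scope.

(** * Ranks, saturated chains, flags, and connectivity of facets *)

Section Faces.
Local Open Scope order_scope.
Variables (d : Order.disp_t) (n : nat) (P : polytope d n).
Implicit Types (x y z F G : P) (C : set P).

Lemma le_rank x y : x <= y -> (rank x <= rank y)%R.
Proof. by rewrite le_eqVlt => /orP[/eqP-> // | /rank_lt/ltW]. Qed.

Lemma rank_ge x : (- 1 <= rank x)%R.
Proof. by rewrite -(rank_bot P) le_rank ?le0x. Qed.

Lemma rank_le x : (rank x <= n%:Z)%R.
Proof. by rewrite -(rank_top P) le_rank ?lex1. Qed.

Lemma comparable_rank_lt x y : x >=< y -> (rank x < rank y)%R -> x < y.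
Proof. by case: comparableP => // [/rank_lt|->] *; lia. Qed.

Lemma comparable_rank_inj x y : x >=< y -> rank x = rank y -> x = y.
Proof. by case: comparableP => // /rank_lt *; lia. Qed.

Lemma le_rank_inj x y : x <= y -> rank x = rank y -> x = y.
Proof. by move=> /le_comparable; apply: comparable_rank_inj. Qed.

(** By [rank_covers], a section with no face strictly inside has rank difference 1. A longer one
    splits at an inner face, and the search continues on the side where [k] lies. *)
Lemma face_of_rank x y (k : int) : x <= y -> (rank x <= k <= rank y)%R ->
  exists2 z, x <= z <= y & rank z = k.
Proof.
have [m] := ubnP `|rank y - rank x|%N; elim: m => // m IHm in x y *.
move=> lt_m xy /andP[xk ky].
have [<-|xNk] := eqVneq (rank x) k; first by exists x; rewrite ?lexx.
have [<-|yNk] := eqVneq (rank y) k; first by exists y; rewrite ?lexx ?xy.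
have xy' : x < y by apply: comparable_rank_lt; [exact: le_comparable | lia].
have [[z /andP[xz zy]]|Nz] := EM (exists z, x < z < y); last first.
  by have := rank_covers (conj xy' Nz); lia.
have := rank_lt xz; have := rank_lt zy => rzy rxz.
have [kz|zk] := leP k (rank z).
  have [|||w /andP[xw wz] <-] := IHm x z; rewrite ?(ltW xz) //; try lia.
  by exists w; rewrite // xw (le_trans wz (ltW zy)).
have [|||w /andP[zw wy] <-] := IHm z y; rewrite ?(ltW zy) //; try lia.
by exists w; rewrite // wy (le_trans (ltW xz) zw).
Qed.

Lemma saturated_chain x y : x <= y -> exists C,
  [/\ chain C, forall z, C z -> x <= z <= y &
      forall k : int, (rank x <= k <= rank y)%R -> exists2 z, C z & rank z = k].
Proof.
have [m] := ubnP `|rank y - rank x|%N; elim: m => // m IHm in x y *.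
move=> lt_m xy; have := le_rank xy => rxy.
have [exy|nxy] := eqVneq (rank x) (rank y).
  exists [set x]; split=> [_ _ -> ->|z ->|k rk]; rewrite ?comparablexx ?lexx ?xy //.
  by exists x => //; lia.
have [|z /andP[xz zy] rz] := face_of_rank (k := rank x + 1) xy; first by lia.
have [||C [chC bC rC]] := IHm z y; rewrite ?zy //; first by lia.
exists (x |` C); split=> [u w|u|k rk].
- case=> [->|Cu] [->|Cw]; rewrite ?comparablexx //; last exact: chC.
    by have /andP[/(le_trans xz)/le_comparable] := bC w Cw.
  by have /andP[/(le_trans xz)/ge_comparable] := bC u Cu.
- case=> [->|/bC/andP[zu ->]]; first by rewrite lexx xy.
  by rewrite (le_trans xz zu).
have [->|nk] := eqVneq k (rank x); first by exists x => //; left.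
have [|w Cw <-] := rC k; first by lia.
by exists w => //; right.
Qed.

Lemma chain_flag C : chain C ->
  (forall k : int, (- 1 <= k <= n%:Z)%R -> exists2 z, C z & rank z = k) ->
  flags P C.
Proof.
move=> chC rC; split=> // D chD CD; apply/seteqP; split=> // x Dx.
have [|z Cz rz] := rC (rank x); first by rewrite rank_ge rank_le.
by rewrite -(comparable_rank_inj (chD _ _ (CD _ Cz) Dx) rz).
Qed.

(** Meant for [U] a chain with a face of every rank from an edge up to [\top]. The two vertices of
    that edge then give flags that differ only in rank 0. *)
Definition flag_over (v : P) (U : set P) : set P := \bot |` (v |` U).

Lemma flag_overP v e U : rank v = 0%R -> rank e = 1%R -> v < e -> chain U ->
  (forall z, U z -> e <= z <= \top) ->
  (forall k : int, (rank e <= k <= rank (\top : P))%R ->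
     exists2 z, U z & rank z = k) ->
  flags P (flag_over v U).
Proof.
move=> rv re ve chU bU rU; apply: chain_flag => [x y|k rk].
  have vU z : U z -> v <= z.
    by move=> /bU/andP[ez _]; apply: le_trans ez; apply: ltW.
  case=> [->|[->|Ux]]; first by rewrite le_comparable ?le0x.
    case=> [->|[->|Uy]]; rewrite ?comparablexx //; first by rewrite ge_comparable ?le0x.
    by rewrite le_comparable ?vU.
  case=> [->|[->|Uy]]; first by rewrite ge_comparable ?le0x.
    by rewrite ge_comparable ?vU.
  exact: chU.
have [->|k1] := eqVneq k (- 1)%R.
  by exists \bot; [left | rewrite rank_bot].
have [->|k0] := eqVneq k 0%R; first by exists v => //; right; left.
have [|z Uz <-] := rU k; first by rewrite re rank_top; lia.
by exists z => //; do 2!right.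
Qed.

Lemma diamond_pair F G : F < G -> (rank G - rank F = 2)%R ->
  exists x y, [/\ x <> y, F < x < G, F < y < G &
                  forall H, F < H < G -> H = x \/ H = y].
Proof.
move=> FG rFG; have /card_set_bijP[f [fI finj fsurj]] := diamond FG rFG.
have [|x Fx fx] := fsurj 0%N; first by [].
have [|y Fy fy] := fsurj 1%N; first by [].
exists x, y; split=> // [exy|H FH]; first by move: fx; rewrite exy fy.
have : (f H < 2)%N := fI _ FH.
case efH: (f H) => [|[|k]] // _; [left|right]; apply: finj; rewrite ?inE //.
  by rewrite efH fx.
by rewrite efH fy.
Qed.

Lemma facet_above x : x < \top -> exists2 F, x <= F & rank F = (n%:Z - 1)%R.
Proof.
move=> xT; have := rank_lt xT; rewrite rank_top => rx.
have [|F /andP[xF _] rF] := @face_of_rank x \top (n%:Z - 1)%R (ltW xT).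
  by rewrite rank_top; lia.
by exists F.
Qed.

(* By descending induction on the rank of a common face [x]: the path between
   two facets above [x] only visits faces strictly above [x]. *)
Lemma facets_connected y (Q : P -> P -> Prop) :
  (forall F, Q F F) -> (forall F G H, Q F G -> Q G H -> Q F H) ->
  (forall H F G, y <= H -> rank H = (n%:Z - 2)%R -> facet F -> facet G ->
     H <= F -> H <= G -> Q F G) ->
  forall F G, facet F -> facet G -> y <= F -> y <= G -> Q F G.
Proof.
move=> Qr Qt Qridge F G fF fG.
suff QH x : y <= x -> x <= F -> x <= G -> Q F G by apply: QH.
have [m] := ubnP `|n%:Z - rank x|%N.
elim: m => // m IHm in x F G fF fG * => lt_m yx xF xG.
have := le_rank xF; have := fF; rewrite /facet => rF rx.
have [exF|nxF] := eqVneq (rank x) (rank F).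
  rewrite -(le_rank_inj xF exF) (le_rank_inj xG _) ?Qr //.
  by rewrite exF fF.
have [rxR|nxR] := eqVneq (rank x) (n%:Z - 2)%R; first exact: (Qridge x).
have ltT (H : P) : facet H -> H < \top.
  rewrite /facet => rH; apply: comparable_rank_lt.
    exact/le_comparable/lex1.
  by rewrite rank_top; lia.
have ltx (H : P) : facet H -> x <= H -> x < H.
  move=> fH xH; apply: comparable_rank_lt; first exact: le_comparable.
  by rewrite fH; lia.
have xT : x < \top by apply: (lt_trans (ltx F _ _)) => //; exact: ltT.
have [||| k [h [h0 hk hb hs]]] := strongly_connected xT _ (x := F) (y := G).
- by rewrite rank_top; lia.
- by rewrite ltx // ltT.
- by rewrite ltx // ltT.
suff Qh i : (i <= k)%N -> forall H, facet H -> h i <= H -> Q F H.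
  by apply: (Qh k) => //; rewrite hk.
elim: i => [|i IHi] ik H fH hH.
  by rewrite -(le_rank_inj _ _ : F = H) //; [rewrite -h0 | rewrite fH].
(* Going down, a facet [H'] above [h i] is also above [h i.+1], whose rank exceeds that of [x], so
   the outer induction links [H'] to [H]. Going up, [H] is already above [h i]. *)
have := hs i ik; case: ifP => _ hi.
  have /andP[xhi hiT] := hb i (ltnW ik).
  have /andP[xhi1 _] := hb i.+1 ik.
  have [H' hH' fH'] := facet_above hiT.
  apply: (Qt _ H'); first exact: IHi (ltnW ik) _ _ _.
  apply: (IHm (h i.+1)) => //; last 2 first.
  - exact: le_trans (ltW xhi1).
  - exact: le_trans hi hH'.
  by have := rank_lt xhi1; have := rank_le (h i.+1); lia.
by apply: IHi (ltnW ik) _ fH _; apply: le_trans hH.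
Qed.

End Faces.

(** * Rigidity of maps that fix part of a section *)

Section Rigidity.
Local Open Scope order_scope.
Variables (d : Order.disp_t) (n : nat) (P : polytope d n).
Implicit Types (x y z a b c R : P) (g h : P -> P).

(** A local form of automorphism: values of [g] off the section below [R] are arbitrary, so maps
    built facet by facet can be total functions on [P]. *)
Definition embeds_below R g : Prop :=
  (forall x y, x <= R -> y <= R -> (g x <= g y) = (x <= y)) /\
  forall x, x <= R -> rank (g x) = rank x.

Definition fixes g a b : Prop := forall x, a <= x <= b -> g x = x.

Lemma embeds_below_inj R g x y : embeds_below R g -> x <= R -> y <= R ->
  g x = g y -> x = y.
Proof.
by move=> [gm _] xR yR e; apply/eqP; rewrite eq_le -(gm x y) // -(gm y x) // e lexx.
Qed.

Lemma embeds_below_sub R S g : embeds_below R g -> S <= R -> embeds_below S g.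
Proof.
move=> [gm gr] SR; split=> [x y xS yS|x xS].
  by rewrite gm // ?(le_trans xS) ?(le_trans yS).
by rewrite gr // (le_trans xS).
Qed.

Lemma embeds_below_comp R S g h : embeds_below R g -> embeds_below S h ->
  (forall x, x <= R -> g x <= S) -> embeds_below R (h \o g).
Proof.
move=> [gm gr] [hm hr] gRS; split=> [x y xR yR|x xR] /=.
  by rewrite hm ?gRS // gm.
by rewrite hr ?gRS // gr.
Qed.

Lemma fixes_short g a b : g a = a -> g b = b -> (rank b <= rank a + 1)%R ->
  fixes g a b.
Proof.
move=> ga gb rab x /andP[ax xb].
have [eax|nax] := eqVneq (rank a) (rank x); first by rewrite -(le_rank_inj ax eax).
have [exb|nxb] := eqVneq (rank x) (rank b); first by rewrite (le_rank_inj xb exb).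
by have := le_rank ax; have := le_rank xb; lia.
Qed.

(* In rank 2 this is the diamond condition; in higher ranks strong
   connectivity moves [c] around the section, one incidence at a time. *)
Lemma fixes_glue R g a c b : embeds_below R g -> b <= R -> a <= c <= b ->
  fixes g a c -> fixes g c b -> fixes g a b.
Proof.
move=> gR bR; have [m] := ubnP `|rank b - rank a|%N.
elim: m => // m IHm in a b c bR * => lt_m /andP[ac cb] gac gcb.
have := le_rank ac; have := le_rank cb => rcb rac.
have [eac|nac] := eqVneq (rank a) (rank c); first by rewrite (le_rank_inj ac eac).
have [ecb|ncb] := eqVneq (rank c) (rank b); first by rewrite -(le_rank_inj cb ecb).
have ac' : a < c by apply: comparable_rank_lt; [exact: le_comparable | lia].
have cb' : c < b by apply: comparable_rank_lt; [exact: le_comparable | lia].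
have ab' := lt_trans ac' cb'.
have ga : g a = a by apply: gac; rewrite lexx ac.
have gb : g b = b by apply: gcb; rewrite lexx cb.
have gc : g c = c by apply: gac; rewrite lexx ac.
move=> x /andP[ax xb].
move: ax; rewrite le_eqVlt => /orP[/eqP <- // | ax].
move: xb; rewrite le_eqVlt => /orP[/eqP -> // | xb].
have xR : x <= R := le_trans (ltW xb) bR.
have aR : a <= R := le_trans (ltW ab') bR.
have cR : c <= R := le_trans cb bR.
have inj := embeds_below_inj gR.
have [eab|nab] := eqVneq (rank b - rank a)%R 2%R.
  have [y [z [nyz ayb azb mid]]] := diamond_pair ab' eab.
  have [->//|nxc] := EM (x = c).
  have gx : a < g x < b.
    rewrite !lt_neqAle -[in a <= _]ga -[in _ <= b]gb !gR.1 // (ltW ax) (ltW xb) !andbT.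
    apply/andP; split; apply/eqP => e.
      by move: ax; rewrite (inj a x) ?ltxx // ga.
    by move: xb; rewrite (inj x b) ?ltxx // gb.
  (* Injectivity keeps [g x] off the fixed face [c], so [g x] must be the other middle face, which
     is [x]. *)
  have gxc : g x <> c by move=> e; apply: nxc; apply: inj; rewrite ?gc.
  have c1 : a < c < b by rewrite ac'.
  have x1 : a < x < b by rewrite ax.
  move: (mid _ c1) (mid _ x1) (mid _ gx) => [] ? [] ? [] ?; congruence.
have [|||k [h [h0 hk hb hs]]] := strongly_connected ab' _ (x := c) (y := x).
- by lia.
- by rewrite ac'.
- by rewrite ax.
(* Invariant along the path. At each step one half is a restriction of the old one; the other lives
   in a section of smaller rank, split at [h i], where the induction applies. *)
suff Fh i : (i <= k)%N -> fixes g a (h i) /\ fixes g (h i) b.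
  by rewrite -hk; have [_ gx] := Fh k (leqnn k); apply: gx; rewrite lexx hk ltW.
elim: i => [_|i IHi ik]; first by rewrite h0.
have [Fa Fb] := IHi (ltnW ik).
have /andP[ai ib] := hb i (ltnW ik); have /andP[ai1 ib1] := hb i.+1 ik.
have := rank_lt ib1; have := rank_lt ai1 => rai rib.
have := hs i ik; case: ifP => _ hi; split.
- by move=> y /andP[ay yi]; apply: Fa; rewrite ay (le_trans yi hi).
- apply: (IHm (h i.+1) b (h i) bR).
  + by move: lt_m rai rib; clear; lia.
  + by rewrite hi ltW.
  + by move=> y /andP[iy yi]; apply: Fa; rewrite yi (le_trans (ltW ai1)).
  + exact: Fb.
- have hiR := le_trans (ltW ib1) bR.
  apply: (IHm a (h i.+1) (h i) hiR).
  + by move: lt_m rai rib; clear; lia.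
  + by rewrite hi ltW.
  + exact: Fa.
  + by move=> y /andP[iy yi]; apply: Fb; rewrite iy (le_trans yi (ltW ib1)).
- by move=> y /andP[iy yb]; apply: Fb; rewrite yb (le_trans hi iy).
Qed.

(** The chain is peeled off from the bottom: its face just above [a] cuts off a section of rank
    difference 1, and [fixes_glue] reattaches it. *)
Lemma fixes_saturated_chain R g a b (C : set P) : embeds_below R g -> b <= R ->
  a <= b -> chain C -> C a -> C b -> (forall x, C x -> g x = x) ->
  (forall k : int, (rank a <= k <= rank b)%R -> exists2 z, C z & rank z = k) ->
  fixes g a b.
Proof.
move=> gR bR; have [m] := ubnP `|rank b - rank a|%N.
elim: m => // m IHm in a * => lt_m ab chC Ca Cb gC rC.
have [short|long] := leP (rank b) (rank a + 1)%R.
  by apply: fixes_short; rewrite ?gC.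
have [|c Cc rc] := rC (rank a + 1)%R; first by lia.
have ac : a < c by apply: comparable_rank_lt; [exact: chC | lia].
have cb : c < b by apply: comparable_rank_lt; [exact: chC | lia].
apply: (fixes_glue (c := c) gR bR); first by rewrite !ltW.
  by apply: fixes_short; rewrite ?gC ?rc.
apply: IHm => //; [by lia | exact: ltW | ].
by move=> k rk; apply: rC; lia.
Qed.

Lemma automorphism_comp g h :
  automorphism g -> automorphism h -> automorphism (g \o h).
Proof.
move=> [gb gm gr] [hb hm hr]; split; first exact: bij_comp.
  by move=> x y /=; rewrite gm hm.
by move=> x /=; rewrite gr hr.
Qed.

Lemma automorphism_embeds R g : automorphism g -> embeds_below R g.
Proof. by case=> _ gm gr; split=> *; rewrite ?gm ?gr. Qed.

End Rigidity.

(** * Swapping the vertices of an edge in [K], in facets and in [P] *)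

Section Reflections.
Local Open Scope order_scope.

(** Regularity carries a flag through [v] to the flag through [v'] with the same faces from [e]
    upwards. Preserving rank, the automorphism fixes those faces one by one, and rigidity extends
    this to the whole section. *)
Lemma regular_vertex_swap (d : Order.disp_t) (n : nat) (K : polytope d n)
    (v v' e : K) : regular_polytope K ->
  rank v = 0%R -> rank v' = 0%R -> rank e = 1%R -> v < e -> v' < e ->
  exists g : K -> K, [/\ automorphism g, g v = v' & fixes g e \top].
Proof.
move=> regK rv rv' re ve ve'.
have [U [chU bU rU]] := saturated_chain (lex1 e).
have flU := flag_overP rv re ve chU bU rU.
have flU' := flag_overP rv' re ve' chU bU rU.
have [g ag gU] := regK _ _ flU flU'; have [_ _ gr] := ag.
have gfix x y : flag_over v U x -> flag_over v' U y -> rank x = rank y -> g x = y.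
  move=> Ux Uy rxy; apply: comparable_rank_inj; last by rewrite gr.
  by apply: flU'.1 => //; rewrite -gU; exists x.
have gUfix u : U u -> g u = u by move=> Uu; apply: gfix => //; do 2!right.
exists g; split=> //; first by apply: gfix; rewrite ?rv //; right; left.
(* [U] only provides faces of the extreme ranks; lying between [e] and [\top], they are [e] and
   [\top] themselves. *)
have [|e' Ue' re'] := rU (rank e); first by rewrite lexx le_rank ?lex1.
have [|t Ut rt] := rU (rank (\top : K)); first by rewrite lexx le_rank ?lex1.
have ee' : e = e' by apply: le_rank_inj => //; case/andP: (bU _ Ue').
have tT : t = \top by apply: le_rank_inj; rewrite ?lex1.
apply: (fixes_saturated_chain (R := \top) (C := U)); rewrite ?lex1 //.
- exact: automorphism_embeds.
- by rewrite ee'.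
- by rewrite -tT.
Qed.

(** The swap in [K] is conjugated by the isomorphism [phi], with [psi] its inverse landing below
    [F]. *)
Lemma facet_reflection (dK dP : Order.disp_t) (n m : nat) (K : polytope dK n)
    (P : polytope dP m) (F v v' e : P) :
  regular_polytope K -> facet_isomorphic K F ->
  rank v = 0%R -> rank v' = 0%R -> rank e = 1%R ->
  v < e -> v' < e -> v <> v' -> e <= F ->
  exists f : P -> P,
    [/\ forall x, x <= F -> f x <= F, embeds_below F f, fixes f e F, f v = v' &
        forall x, x <= F -> f (f x) = x].
Proof.
move=> regK [phi [[phiS phiI phiO] phim phir]] rv rv' re ve ve' vv' eF.
have /choice[psi psiP] : forall k, exists x, x <= F /\ phi x = k.
  by move=> k; have [x /andP[_ xF] <-] := phiO k I; exists x.
have psiF k : psi k <= F by case: (psiP k).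
have psiK k : phi (psi k) = k by case: (psiP k).
have phiK x : x <= F -> psi (phi x) = x.
  by move=> xF; apply: phiI; rewrite ?inE /= ?le0x ?psiF ?psiK.
have vF := le_trans (ltW ve) eF; have vF' := le_trans (ltW ve') eF.
have phi_lt x : x < e -> phi x < phi e.
  move=> xe; apply: comparable_rank_lt.
    by apply: le_comparable; rewrite phim ?(ltW xe) // (le_trans (ltW xe)).
  by rewrite !phir ?rank_lt // (le_trans (ltW xe)).
have [||||| g [[_ gm gr] gv ge]] :=
  @regular_vertex_swap _ _ K (phi v) (phi v') (phi e) regK;
  rewrite ?phir ?phi_lt //.
pose f := psi \o g \o phi.
have fF x : f x <= F by exact: psiF.
have fe : embeds_below F f.
  split=> [x y xF yF|x xF]; rewrite /f /=.
    by rewrite -phim ?psiK ?gm ?phim ?psiF.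
  by rewrite -phir ?psiK ?gr ?phir ?psiF.
have fix_e : fixes f e F.
  by move=> x /andP[ex xF]; rewrite /f /= ge ?phiK // lex1 phim ?ex.
have fv : f v = v' by rewrite /f /= gv phiK.
have e0 : \bot < e.
  by apply: comparable_rank_lt; [exact/le_comparable/le0x | rewrite rank_bot re].
have v0 x : x <= e -> rank x = 0%R -> \bot < x < e.
  move=> xe rx; apply/andP; split; apply: comparable_rank_lt.
  - exact/le_comparable/le0x.
  - by rewrite rank_bot rx.
  - exact: le_comparable.
  - by rewrite rx re.
(* By the diamond condition [v] and [v'] are the only vertices of [e], and injectivity excludes
   [f v' = v']. *)
have fv' : f v' = v.
  have fve : f v' <= e.
    by rewrite -(fix_e e) ?fe.1 ?(ltW ve') // lexx eF.
  have [|a [b [_ _ _ mid]]] := diamond_pair e0; first by rewrite rank_bot re.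
  have fvv : f v' <> v'.
    by move=> fv1; apply: vv'; apply: (embeds_below_inj fe vF vF'); rewrite fv.
  have rfv : rank (f v') = 0%R by rewrite fe.2.
  have := mid _ (v0 _ fve rfv); have := mid _ (v0 _ (ltW ve) rv).
  have := mid _ (v0 _ (ltW ve') rv').
  by move=> [] ? [] ? [] ?; congruence.
exists f; split=> // x xF.
have ffe : embeds_below F (f \o f) by apply: (embeds_below_comp fe fe).
(* The square fixes [\bot], [v] and everything from [e] to [F]; gluing at [e] and then at [v] makes
   it the identity below [F]. *)
suff ff : fixes (f \o f) \bot F by apply: ff; rewrite le0x.
have ffeF : fixes (f \o f) e F by move=> y yF /=; rewrite (fix_e y) // fix_e.
have ff0 : (f \o f) \bot = \bot.
  apply: esym; apply: le_rank_inj; first exact: le0x.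
  by rewrite ffe.2 ?le0x.
have ffv : (f \o f) v = v by rewrite /= fv fv'.
apply: (fixes_glue (c := e) ffe) => //; first by rewrite le0x.
apply: (fixes_glue (c := v) ffe) => //; first by rewrite le0x ltW.
  by apply: fixes_short; rewrite // rv rank_bot.
by apply: fixes_short; rewrite ?re ?rv // ffeF // lexx eF.
Qed.

(** Both maps fix [R], so [g \o f] acts below [R]. It fixes [\bot], [v] and all faces from [e] to
    [R], hence is the identity there. *)
Lemma reflection_agree (d : Order.disp_t) (n : nat) (P : polytope d n)
    (f g : P -> P) (F G R v e : P) :
  rank v = 0%R -> rank e = 1%R -> v < e -> e <= R -> R <= F -> R <= G ->
  embeds_below F f -> embeds_below G g -> fixes f e F -> fixes g e G ->
  f v = g v -> (forall x, x <= G -> g (g x) = x) ->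
  forall x, x <= R -> f x = g x.
Proof.
move=> rv re ve eR RF RG fF gG fe ge fgv gg x xR.
have fR y : y <= R -> f y <= R.
  move=> yR; rewrite -[in X in _ <= X](fe R) ?eR //.
  by rewrite fF.1 // (le_trans yR).
have fR' := embeds_below_sub fF RF; have gR' := embeds_below_sub gG RG.
have h : embeds_below R (g \o f) by apply: (embeds_below_comp fR' gR').
have vR := le_trans (ltW ve) eR.
have hv : (g \o f) v = v by rewrite /= fgv gg // (le_trans vR).
have heR : fixes (g \o f) e R.
  move=> y /andP[ey yR] /=; rewrite fe ?ge ?ey //.
    exact: le_trans yR RG.
  exact: le_trans yR RF.
have h0 : (g \o f) \bot = \bot.
  by apply: esym; apply: le_rank_inj; rewrite ?le0x // h.2 ?le0x.
suff hR : fixes (g \o f) \bot R.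
  (* [f x = g (g (f x)) = g x]. *)
  rewrite -[LHS]gg; last exact: le_trans (fR x xR) RG.
  by have /= -> := hR x _; rewrite ?le0x.
apply: (fixes_glue (c := e) h) => //; first by rewrite le0x.
apply: (fixes_glue (c := v) h) => //; first by rewrite le0x ltW.
  by apply: fixes_short; rewrite // rv rank_bot.
by apply: fixes_short; rewrite ?re ?rv // heR // lexx eR.
Qed.

(** Each face other than [\top] is moved by the map of any facet above it. A facet above the larger
    of two comparable faces contains both, so order is preserved; being an involution, [g] also
    reflects it. *)
Lemma glue_facet_maps (d : Order.disp_t) (n : nat) (P : polytope d n)
    (f : P -> P -> P) :
  (forall F, facet F ->
     [/\ forall x, x <= F -> f F x <= F, embeds_below F (f F) &
         forall x, x <= F -> f F (f F x) = x]) ->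
  (forall x F G, facet F -> facet G -> x <= F -> x <= G -> f F x = f G x) ->
  exists g : P -> P, [/\ automorphism g, involutive g &
    forall x F, facet F -> x <= F -> g x = f F x].
Proof.
move=> fP agree.
have /choice[up upP] : forall x : P, exists F, x < \top -> x <= F /\ facet F.
  move=> x; have [/facet_above[F xF rF]|xT] := EM (x < \top); first by exists F.
  by exists x.
pose g x := if x == \top then \top else f (up x) x.
have ltT (x : P) : x != \top -> x < \top by move=> xT; rewrite lt_neqAle xT lex1.
have NT (F : P) : facet F -> F != \top.
  by move=> rF; apply/eqP => e; move: rF; rewrite /facet e rank_top; lia.
have gE x F : facet F -> x <= F -> g x = f F x.
  move=> fF xF; have xT : x != \top.
    by apply: contraNneq (NT _ fF) => xT; rewrite eq_le lex1 -xT.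
  rewrite /g (negbTE xT); have [xu fu] := upP x (ltT _ xT); exact: agree.
have gT : g \top = \top by rewrite /g eqxx.
have gg : involutive g.
  move=> x; have [->|xT] := eqVneq x \top; first by rewrite !gT.
  have [xu fu] := upP x (ltT _ xT); have [uF _ ff] := fP _ fu.
  by rewrite (gE _ _ fu xu) (gE _ _ fu) ?uF // ff.
have gle x y : x <= y -> g x <= g y.
  have [->|yT] := eqVneq y \top; first by rewrite gT lex1.
  have [yu fu] := upP y (ltT _ yT); have [_ [fm _] _] := fP _ fu => xy.
  have xu := le_trans xy yu.
  by rewrite (gE _ _ fu yu) (gE _ _ fu xu) fm.
exists g; split=> //; split; first by exists g.
  by move=> x y; apply/idP/idP => /gle //; rewrite !gg.
move=> x; have [->|xT] := eqVneq x \top; first by rewrite gT.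
have [xu fu] := upP x (ltT _ xT); have [_ [_ fr] _] := fP _ fu.
by rewrite (gE _ _ fu xu) fr.
Qed.

(** [g] exchanges two adjacent flags, over [v] and over [v'], so their orbits coincide. *)
Lemma vertex_swap_not_chiral (d : Order.disp_t) (n : nat) (P : polytope d n)
    (g : P -> P) (v v' e : P) :
  rank v = 0%R -> rank v' = 0%R -> rank e = 1%R -> v < e -> v' < e -> v <> v' ->
  automorphism g -> involutive g -> g v = v' -> fixes g e \top ->
  ~ chiral_polytope P.
Proof.
move=> rv rv' re ve ve' vv' ag gg gv ge [_ chir].
have [U [chU bU rU]] := saturated_chain (lex1 e).
have flU := flag_overP rv re ve chU bU rU.
have flU' := flag_overP rv' re ve' chU bU rU.
have NU x : rank x = 0%R -> ~ U x.
  by move=> rx /bU/andP[/le_rank]; rewrite rx re.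
have N0 (x : P) : rank x = 0%R -> x <> \bot by move=> + x0; rewrite x0 rank_bot.
have over_diff x y : rank x = 0%R -> x <> y ->
    flag_over x U `\` flag_over y U = [set x].
  move=> rx xy; apply/seteqP; split=> [z [[->|[->|Uz]] NUy] //|z ->].
  - by case: NUy; left.
  - by case: NUy; do 2!right.
  - split; first by right; left.
    by case=> [x0|[exy|Ux]]; [apply: (N0 x) | apply: xy | apply: (NU x)].
have g0 : g \bot = \bot.
  by case: ag => _ _ gr; apply: esym; apply: le_rank_inj; rewrite ?le0x ?gr.
have gU x : U x -> g x = x by move=> /bU; apply: ge.
have gv' : g v' = v by rewrite -gv gg.
have gover x y : g x = y -> forall z, flag_over x U z -> flag_over y U (g z).
  move=> gx z [->|[->|Uz]]; first by rewrite g0; left.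
    by rewrite gx; right; left.
  by do 2!right; rewrite gU.
(* The image under [h] of the flag over [x] is the image under [h \o g] of the flag over [y]. *)
have orbit_sub x y : g x = y -> g y = x ->
    flag_orbit (flag_over x U) `<=` flag_orbit (flag_over y U).
  move=> gx gy D [h ah <-]; exists (h \o g); first exact: automorphism_comp.
  apply/seteqP; split=> [_ [z zU <-]|_ [z zU <-]] /=.
    by exists (g z) => //; apply: gover zU.
  by exists (g z); [apply: gover zU | rewrite /= gg].
apply: (chir _ _ flU flU').
  by exists v, v'; split; apply: over_diff => //; apply: nesym.
by apply/seteqP; split; apply: orbit_sub.
Qed.

End Reflections.

(** * From flatness to a global reflection of [P] *)

Theorem theorem3p2 (n : nat) (dK : Order.disp_t) (K : polytope dK n) :
  regular_polytope K -> flat K 1 (n%:Z - 1) ->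
  forall (dP : Order.disp_t),
  ~ exists P : polytope dP n.+1,
      [/\ finite_set [set: P], chiral_polytope P
        & has_facets_isomorphic_to P K].
Proof.
move=> regK [_ n3 _ flatK] dP [P [_ chirP isoP]].
have T0 : (\bot < \top :> P)%O.
  apply: comparable_rank_lt; first exact/le_comparable/lex1.
  by rewrite rank_bot rank_top.
have [F0 _ fF0] := facet_above T0.
have [|e /andP[_ eF0] re] := face_of_rank (k := 1) (le0x F0).
  by rewrite rank_bot fF0; lia.
have e0 : (\bot < e)%O.
  by apply: comparable_rank_lt; [exact/le_comparable/le0x | rewrite rank_bot re].
have [|v [v' [vv' /andP[v0 ve] /andP[v0' ve'] _]]] := diamond_pair e0.
  by rewrite rank_bot re.
have rank0 x : (\bot < x)%O -> (x < e)%O -> rank x = 0.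
  by move=> /rank_lt + /rank_lt; rewrite rank_bot re; lia.
have rv := rank0 _ v0 ve; have rv' := rank0 _ v0' ve'.
(* A ridge of [P] has rank [n - 1], so within [F] it corresponds to a facet of [K]. Flatness makes
   it comparable to [e], and [1 < n - 1] gives the direction. *)
have e_ridge (H F : P) : facet F -> rank H = n.+1%:Z - 2 ->
    (e <= F)%O -> (H <= F)%O -> (e <= H)%O.
  move=> fF rH eF HF; have [phi [_ phim phir]] := isoP F fF.
  rewrite -phim //; apply/ltW/comparable_rank_lt; last by rewrite !phir // re rH; lia.
  by apply: flatK; rewrite phir // rH; lia.
have eF (F : P) : facet F -> (e <= F)%O.
  move=> fF.
  apply: (@facets_connected _ _ P \bot%O (fun F G => (e <= F)%O -> (e <= G)%O)
            _ _ _ F0 F); rewrite ?le0x //; first by move=> ? ? ? FG GH /FG.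
  by move=> H G G' _ rH fG fG' HG HG' eG; apply: le_trans (e_ridge H G _ _ _ _) HG'.
have /choice[f fP] : forall F : P, exists f : P -> P, facet F ->
    [/\ forall x, (x <= F)%O -> (f x <= F)%O, embeds_below F f, fixes f e F,
        f v = v' & forall x, (x <= F)%O -> f (f x) = x].
  move=> F; have [fF|] := EM (facet F); last by exists id.
  have [g gP] := facet_reflection regK (isoP F fF) rv rv' re ve ve' vv' (eF F fF).
  by exists g.
have agree (x F G : P) : facet F -> facet G -> (x <= F)%O -> (x <= G)%O ->
    f F x = f G x.
  (* Connectivity is taken above [x], so every ridge crossed contains [x] and [reflection_agree]
     applies to it. *)
  move: F G; apply: facets_connected => [//|F G H -> //|R F G xR rR fF fG RF RG].
  have [_ emF fixF fvF _] := fP _ fF; have [_ emG fixG fvG ffG] := fP _ fG.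
  have eR := e_ridge R F fF rR (eF F fF) RF.
  by apply: (reflection_agree rv re ve eR RF RG) => //; rewrite fvF.
have [|g [ag gg gE]] := glue_facet_maps _ agree.
  by move=> F fF; have [? ? _ _ ?] := fP _ fF.
have [_ _ fixF0 fvF0 _] := fP _ fF0.
apply: (vertex_swap_not_chiral rv rv' re ve ve' vv' ag gg _ _ chirP).
  by rewrite (gE _ F0) // (le_trans (ltW ve)).
(* [\top] lies in no facet and is fixed because [g] preserves rank. *)
move=> x /andP[ex _]; have [->|xT] := eqVneq x \top%O.
  by have [_ _ gr] := ag; apply: le_rank_inj; rewrite ?lex1 ?gr.
have [|F xF fF] := @facet_above _ _ P x; first by rewrite lt_neqAle xT lex1.
by have [_ _ fixF _ _] := fP _ fF; rewrite (gE _ F) ?fixF ?ex.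
Qed.
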